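(* Let $\mathcal{L}$ be the syntax category, let $f,g\colon\mathcal{L}\to[0,1]$ be $[0,1]$-copresheaves, and let $w_1,w_2\in[0,1]$. Let $\mathcal{J}$ be the discrete $[0,1]$-category with two objects $1,2$ and $\mathcal{J}(i,j)=\delta_{ij}$, let $W\colon\mathcal{J}\to[0,1]$ be the functor of weights $W(1)=w_1$, $W(2)=w_2$, and let $F\colon\mathcal{J}\to\widehat{\mathcal{L}}$ be the diagram $F(1)=f$, $F(2)=g$. Then the weighted limit $(w_1,f)\times(w_2,g):=\lim_W F$ exists in $\widehat{\mathcal{L}}$, and it is the copresheaf $\mathcal{L}\to[0,1]$ given by $$c\mapsto \min\left\{\frac{fc}{w_1},\frac{gc}{w_2},1\right\}.$$
   Context: The unit interval $[0,1]$ is a commutative monoidal preorder under $\le$ and multiplication, with internal hom $[a,b]:=b/a$ if $b<a$ and $[a,b]:=1$ otherwise; thus $[a,b]=\min\{b/a,1\}$ with the convention that $b/0\ge 1$ for all $0\le b\le 1$ (so $b/0$ never lowers a minimum with $1$). A $[0,1]$-category $\mathcal{C}$ is a set of objects with numbers $\mathcal{C}(x,y)\in[0,1]$ such that $\mathcal{C}(x,x)=1$ and $\mathcal{C}(y,z)\mathcal{C}(x,y)\le\mathcal{C}(x,z)$ for all $x,y,z$. A $[0,1]$-functor $F\colon \mathcal{C}\to\mathcal{D}$ is a function on objects with $\mathcal{C}(x,y)\le\mathcal{D}(Fx,Fy)$. A $[0,1]$-copresheaf on $\mathcal{C}$ is a function $f\colon\mathcal{C}\to[0,1]$ with $\mathcal{C}(x,y)\le[fx,fy]$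 for all $x,y$. The $[0,1]$-category of copresheaves $\widehat{\mathcal{C}}=[0,1]^{\mathcal{C}}$ has hom objects $\widehat{\mathcal{C}}(f,g)=\inf_{c\in\mathcal{C}}[fc,gc]$. The syntax category $\mathcal{L}$ is the $[0,1]$-category whose objects are the expressions (texts) of a language and whose hom objects are $\mathcal{L}(x,y):=\pi(y|x)\in[0,1]$, the probability that $y$ extends $x$, where $\pi(y|x)=0$ if $x$ is not a subtext of $y$; being a $[0,1]$-category means $\pi(x|x)=1$ and $\pi(z|y)\pi(y|x)\le\pi(z|x)$ for all $x,y,z$. The weighted limit $\lim_W F$ is an object of $\widehat{\mathcal{L}}$ such that $\widehat{\mathcal{L}}(Z,\lim_WF)=[0,1]^{\mathcal{J}}(W,\widehat{\mathcal{L}}(Z,F))$ for every copresheaf $Z$ on $\mathcal{L}$, where $\widehat{\mathcal{L}}(Z,F)\colon\mathcal{J}\to[0,1]$ is $i\mapsto\widehat{\mathcal{L}}(Z,F(i))$ and $[0,1]^{\mathcal{J}}(W,V)=\min_{i\in\{1,2\}}[W(i),V(i)]$. *)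

(* Defs.v *)
From mathcomp Require Import all_boot all_order all_algebra.
From mathcomp Require Import classical_sets reals interval_inference.

Set Implicit Arguments.
Unset Strict Implicit.
Unset Printing Implicit Defensive.

Import Order.TTheory GRing.Theory Num.Theory.
Local Open Scope classical_set_scope.
Local Open Scope ring_scope.

(* MathComp has [b / 0 = 0]; here [b / 0] has to be at least 1, and only
   appears in minima with 1. *)
Definition quot {R : realType} (b a : {i01 R}) : R :=
  if a%:num == 0 then 1 else b%:num / a%:num.

Definition ihom_val {R : realType} (a b : {i01 R}) : R :=
  if b%:num < a%:num then b%:num / a%:num else 1.

Lemma ihom_val_ge0 (R : realType) (a b : {i01 R}) : 0 <= ihom_val a b.
Proof. by rewrite /ihom_val; case: ifP => // _; rewrite divr_ge0. Qed.

Lemma ihom_val_le1 (R : realType) (a b : {i01 R}) : ihom_val a b <= 1.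
Proof.
rewrite /ihom_val; case: ifP => // ba.
by rewrite ler_pdivrMr ?mul1r ?ltW // (le_lt_trans _ ba).
Qed.

Definition ihom {R : realType} (a b : {i01 R}) : {i01 R} :=
  Itv01 (ihom_val_ge0 a b) (ihom_val_le1 a b).

Lemma le_ihom (R : realType) (z : R) (a b : {i01 R}) :
  z <= 1 -> (z <= (ihom a b)%:num) = (z * a%:num <= b%:num).
Proof.
move=> z1; rewrite /= /ihom_val; case: ltP => ba.
  by rewrite ler_pdivlMr // (le_lt_trans _ ba).
by rewrite z1 (le_trans _ ba) // ler_piMl.
Qed.

(* The point 1 makes the infimum of the empty family equal to 1, the top
   element of [0,1] ([inf set0 = 0] in R); it changes no other infimum. *)
Definition inf01_set {R : realType} {I : Type} (h : I -> {i01 R}) : set R :=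
  1 |` range (fun i => (h i)%:num).

Lemma inf01_set_lb (R : realType) (I : Type) (h : I -> {i01 R}) :
  lbound (inf01_set h) 0.
Proof. by move=> _ [->|[i _ <-]]. Qed.

Lemma inf01_ge0 (R : realType) (I : Type) (h : I -> {i01 R}) :
  0 <= inf (inf01_set h).
Proof. by apply: lb_le_inf (@inf01_set_lb _ _ h); exists 1; left. Qed.

Lemma inf01_le1 (R : realType) (I : Type) (h : I -> {i01 R}) :
  inf (inf01_set h) <= 1.
Proof. by apply: ge_inf; [exists 0; exact: inf01_set_lb | left]. Qed.

Definition inf01 {R : realType} {I : Type} (h : I -> {i01 R}) : {i01 R} :=
  Itv01 (inf01_ge0 h) (inf01_le1 h).

Lemma le_inf01 (R : realType) (I : Type) (h : I -> {i01 R}) (z : R) :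
  z <= 1 -> z <= (inf01 h)%:num <-> forall i, z <= (h i)%:num.
Proof.
move=> z1; split=> [zh i|zh].
  apply: le_trans zh _; apply: ge_inf; last by right; exists i.
  by exists 0; exact: inf01_set_lb.
by apply: lb_le_inf; [exists 1; left | move=> _ [->|[i _ <-]]].
Qed.

Record ucat (R : realType) := UCat {
  obj :> Type;
  hom : obj -> obj -> {i01 R};
  hom_refl : forall x, (hom x x)%:num = 1;
  hom_comp : forall x y z,
    (hom y z)%:num * (hom x y)%:num <= (hom x z)%:num }.

Record ufunctor (R : realType) (C D : ucat R) := UFunctor {
  fobj :> C -> D;
  fobj_hom : forall x y, (hom x y)%:num <= (hom (fobj x) (fobj y))%:num }.

Lemma ihom_refl (R : realType) (a : {i01 R}) : (ihom a a)%:num = 1.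
Proof. by rewrite /= /ihom_val ltxx. Qed.

Lemma ihom_comp (R : realType) (a b c : {i01 R}) :
  (ihom b c)%:num * (ihom a b)%:num <= (ihom a c)%:num.
Proof.
rewrite le_ihom ?mulr_ile1// -mulrA.
apply: (@le_trans _ _ ((ihom b c)%:num * b%:num)).
  by rewrite ler_wpM2l // -le_ihom.
by rewrite -le_ihom.
Qed.

Definition unit_interval (R : realType) : ucat R :=
  UCat (@ihom_refl R) (@ihom_comp R).

Definition copresheaf (R : realType) (C : ucat R) : Type :=
  ufunctor C (unit_interval R).

Definition copresheaf_hom (R : realType) (C : ucat R) (f g : copresheaf C) :
  {i01 R} := inf01 (fun c : C => ihom (f c) (g c)).

Lemma copresheaf_hom_refl (R : realType) (C : ucat R) (f : copresheaf C) :
  (copresheaf_hom f f)%:num = 1.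
Proof.
apply/eqP; rewrite eq_le; apply/andP; split; first exact: inf01_le1.
by apply/(le_inf01 _ (lexx 1)) => c; rewrite ihom_refl.
Qed.

Lemma copresheaf_hom_comp (R : realType) (C : ucat R) (f g h : copresheaf C) :
  (copresheaf_hom g h)%:num * (copresheaf_hom f g)%:num
  <= (copresheaf_hom f h)%:num.
Proof.
set u := copresheaf_hom g h; set v := copresheaf_hom f g.
apply/le_inf01 => [|c]; first by rewrite mulr_ile1.
apply: le_trans (ihom_comp _ (g c) _).
have uc : u%:num <= (ihom (g c) (h c))%:num.
  by apply: (iffLR (@le_inf01 _ _ (fun c => ihom (g c) (h c)) u%:num _)).
have vc : v%:num <= (ihom (f c) (g c))%:num.
  by apply: (iffLR (@le_inf01 _ _ (fun c => ihom (f c) (g c)) v%:num _)).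
exact: ler_pM.
Qed.

Definition copresheaf_cat (R : realType) (C : ucat R) : ucat R :=
  UCat (@copresheaf_hom_refl R C) (@copresheaf_hom_comp R C).

Lemma hom_into_subproof (R : realType) (J C : ucat R) (z : C)
    (F : ufunctor J C) (i j : J) :
  (hom i j)%:num
  <= (hom (hom z (F i) : unit_interval R) (hom z (F j)))%:num.
Proof.
rewrite le_ihom //; apply: le_trans (hom_comp z (F i) (F j)).
by rewrite ler_wpM2r // fobj_hom.
Qed.

Definition hom_into (R : realType) (J C : ucat R) (z : C) (F : ufunctor J C) :
  copresheaf J :=
  @UFunctor R J (unit_interval R) (fun i => hom z (F i))
    (hom_into_subproof z F).

Definition is_weighted_limit (R : realType) (J C : ucat R) (W : copresheaf J)
    (F : ufunctor J C) (l : C) : Prop :=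
  forall z : C, hom z l = hom (W : copresheaf_cat J) (hom_into z F).

Definition discrete_hom (R : realType) (I : eqType) (i j : I) : {i01 R} :=
  if i == j then 1%:i01 else 0%:i01.

Lemma discrete_hom_refl (R : realType) (I : eqType) (i : I) :
  (discrete_hom R i i)%:num = 1.
Proof. by rewrite /discrete_hom eqxx. Qed.

Lemma discrete_hom_comp (R : realType) (I : eqType) (i j k : I) :
  (discrete_hom R j k)%:num * (discrete_hom R i j)%:num
  <= (discrete_hom R i k)%:num.
Proof.
rewrite {1 2}/discrete_hom; case: (eqVneq j k) => [->|_]; last by rewrite mul0r.
case: (eqVneq i k) => [->|_]; last by rewrite mulr0.
by rewrite discrete_hom_refl mulr1.
Qed.

Definition discrete_cat (R : realType) (I : eqType) : ucat R :=
  UCat (@discrete_hom_refl R I) (@discrete_hom_comp R I).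

Lemma discrete_functor_subproof (R : realType) (I : eqType) (D : ucat R)
    (F : I -> D) (i j : I) :
  (discrete_hom R i j)%:num <= (hom (F i) (F j))%:num.
Proof.
rewrite /discrete_hom; case: (eqVneq i j) => [->|_] /=; last by [].
by rewrite hom_refl.
Qed.

Definition discrete_functor (R : realType) (I : eqType) (D : ucat R)
    (F : I -> D) : ufunctor (discrete_cat R I) D :=
  @UFunctor R (discrete_cat R I) D F (discrete_functor_subproof F).

(* Texts are finite strings over an alphabet, a language is any set of them,
   and x is a subtext of y when it occurs in y as a contiguous substring.
   [cond_prob y x] is pi(y|x). *)
Record language (R : realType) (A : eqType) := Language {
  text : pred (seq A);
  cond_prob : {x | text x} -> {x | text x} -> {i01 R};
  cond_prob_subtext : forall x y,
    ~~ infix (val x) (val y) -> (cond_prob y x)%:num = 0;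
  cond_prob_refl : forall x, (cond_prob x x)%:num = 1;
  cond_prob_comp : forall x y z,
    (cond_prob z y)%:num * (cond_prob y x)%:num <= (cond_prob z x)%:num }.

Definition syntax_cat (R : realType) (A : eqType) (L : language R A) : ucat R :=
  @UCat R {x | text L x} (fun x y => cond_prob y x)
    (@cond_prob_refl R A L) (@cond_prob_comp R A L).

(* The objects 1 and 2 of the two-object discrete category are [true] and
   [false]. *)
Definition pair_diagram (R : realType) (D : ucat R) (x y : D) :
  ufunctor (discrete_cat R bool) D :=
  discrete_functor (fun i => if i then x else y).

(* Main.v *)
Require Import Defs.
From mathcomp Require Import all_boot all_order all_algebra.
From mathcomp Require Import classical_sets reals interval_inference.

Set Implicit Arguments.
Unset Strict Implicit.
Unset Printing Implicit Defensive.

Import Order.TTheory GRing.Theory Num.Theory.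
Local Open Scope ring_scope.

(** Weighted limits of copresheaves are computed pointwise, for any [J]: the value at [c] is the
    infimum over [i] of [[W i, F i c]]. By the adjunction [z * a <= b] iff [z <= [a, b]]
    ([le_ihom]), a number [r <= 1] lies below either side of the universal property exactly when
    [r * z c * W i <= F i c] for all [c] and [i]; numbers with the same lower bounds are equal
    ([eq_i01]), which gives [wlimP]. A Yoneda argument, [is_weighted_limit_unique], transfers the
    formula to every limit. For two objects the infimum is a minimum, and [ihom_quot] turns homs
    into truncated quotients. *)

Lemma eq_i01 (R : realType) (a b : {i01 R}) :
  (forall z : R, z <= 1 -> z <= a%:num <-> z <= b%:num) -> a = b.
Proof.
move=> ab; apply/val_inj/le_anti/andP; split.
  exact: (iffLR (ab _ (le1 a))).
exact: (iffRL (ab _ (le1 b))).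
Qed.

Lemma le_copresheaf_hom (R : realType) (C : ucat R) (f g : copresheaf C)
    (z : R) : z <= 1 ->
  z <= (copresheaf_hom f g)%:num <-> forall c, z * (f c)%:num <= (g c)%:num.
Proof.
by move=> z1; rewrite le_inf01//; split=> h c; [rewrite -le_ihom | rewrite le_ihom].
Qed.

Lemma copresheaf_hom_eq1 (R : realType) (C : ucat R) (f g : copresheaf C) :
  (copresheaf_hom f g)%:num = 1 -> forall c, (f c)%:num <= (g c)%:num.
Proof.
move=> fg1 c; rewrite -[leLHS]mul1r.
by apply: (iffLR (le_copresheaf_hom f g (lexx 1))); rewrite fg1.
Qed.

Section CopresheafLimit.
Variables (R : realType) (J C : ucat R) (W : copresheaf J).
Variable F : ufunctor J (copresheaf_cat C).

Definition wlim_val (c : C) : {i01 R} :=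
  inf01 (fun i : J => ihom (W i) ((F i : copresheaf C) c)).

Lemma le_wlim_val (c : C) (z : R) : z <= 1 ->
  z <= (wlim_val c)%:num <->
  forall i, z * (W i)%:num <= ((F i : copresheaf C) c)%:num.
Proof.
by move=> z1; rewrite le_inf01//; split=> h i; [rewrite -le_ihom | rewrite le_ihom].
Qed.

(** Each [F i] is a copresheaf, so [hom x y * wlim_val x * W i <= hom x y * F i x <= F i y]. *)
Lemma wlim_val_hom (x y : C) :
  (Defs.hom x y)%:num <= (Defs.hom (wlim_val x : unit_interval R) (wlim_val y))%:num.
Proof.
rewrite le_ihom//; apply/le_wlim_val => [|i]; first by rewrite mulr_ile1.
rewrite -mulrA.
apply: (@le_trans _ _ ((Defs.hom x y)%:num * ((F i : copresheaf C) x)%:num)).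
  by rewrite ler_wpM2l//; exact: (iffLR (le_wlim_val _ (le1 _))).
by rewrite -le_ihom//; exact: (fobj_hom (F i : copresheaf C)).
Qed.

Definition wlim : copresheaf C :=
  @UFunctor R C (unit_interval R) wlim_val wlim_val_hom.

(* Both sides are the infimum over all [c] and [i] of the double hom
   [[z c * W i, F i c]]. *)
Lemma wlimP : is_weighted_limit W F wlim.
Proof.
move=> z; apply: eq_i01 => r r1.
(* Homs are capped at 1, so the adjunction applies only to factors at most 1, here [r * z c] and
   [r * W i]. *)
have rM (a : {i01 R}) : r * a%:num <= 1.
  by apply: le_trans (le1 a); rewrite ler_piMl.
rewrite !le_copresheaf_hom//; split=> h.
  move=> i; apply/le_copresheaf_hom => // c.
  by rewrite mulrAC; exact: (iffLR (le_wlim_val _ (rM _))).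
move=> c; apply/le_wlim_val => // i.
by rewrite mulrAC; exact: (iffLR (le_copresheaf_hom _ _ (rM _))).
Qed.

End CopresheafLimit.

(** Testing each universal property at [l] and at [l'] gives homs equal to 1 in both directions,
    that is, pointwise inequalities both ways; antisymmetry of the order on the unit interval
    concludes. *)
Lemma is_weighted_limit_unique (R : realType) (J C : ucat R)
    (W : copresheaf J) (F : ufunctor J (copresheaf_cat C))
    (l l' : copresheaf C) :
  is_weighted_limit W F l -> is_weighted_limit W F l' ->
  forall c, l c = l' c.
Proof.
move=> lP l'P c.
have ll' : copresheaf_hom l l' = copresheaf_hom l l.
  exact: etrans (l'P l) (esym (lP l)).
have l'l : copresheaf_hom l' l = copresheaf_hom l' l'.
  exact: etrans (lP l') (esym (l'P l')).
apply/val_inj/le_anti/andP; split; apply: copresheaf_hom_eq1.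
  by rewrite ll' copresheaf_hom_refl.
by rewrite l'l copresheaf_hom_refl.
Qed.

Lemma ihom_quot (R : realType) (a b : {i01 R}) :
  (ihom a b)%:num = Num.min (quot b a) 1.
Proof.
rewrite /= /ihom_val /quot; case: eqP => [a0|/eqP a0].
  (* For [a = 0] both sides are 1: [b < 0] is impossible, and [quot] is 1 by convention. *)
  by rewrite minxx a0 ltNge ge0.
have a_gt0 : 0 < a%:num by rewrite lt0r a0 ge0.
case: ltP => ab; first by rewrite min_l// ler_pdivrMr// mul1r ltW.
by rewrite min_r// ler_pdivlMr// mul1r.
Qed.

Lemma inf01_bool (R : realType) (h : bool -> {i01 R}) :
  (inf01 h)%:num = Num.min (h true)%:num (h false)%:num.
Proof.
apply/le_anti/andP; split.
  by rewrite le_min; apply/andP; split; exact: (iffLR (le_inf01 _ (le1 _))).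
apply/le_inf01 => [|[]]; by rewrite ge_min ?le1 ?lexx ?orbT.
Qed.

Theorem theorem2 (R : realType) (A : eqType) (L : language R A)
    (f g : copresheaf (syntax_cat L)) (w1 w2 : {i01 R}) :
  let W : copresheaf (discrete_cat R bool) :=
    pair_diagram (w1 : unit_interval R) w2 in
  let F : ufunctor (discrete_cat R bool) (copresheaf_cat (syntax_cat L)) :=
    pair_diagram (f : copresheaf_cat (syntax_cat L)) g in
  (exists l : copresheaf (syntax_cat L), is_weighted_limit W F l) /\
  (forall l : copresheaf (syntax_cat L), is_weighted_limit W F l ->
     forall c : syntax_cat L,
       (l c)%:num = Num.min (quot (f c) w1) (Num.min (quot (g c) w2) 1)).
Proof.
move=> W F; split; first by exists (wlim W F); exact: wlimP.
move=> l lP c; rewrite (is_weighted_limit_unique lP (@wlimP _ _ _ W F)).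
(* The two truncations at 1 merge into one. *)
by rewrite inf01_bool !ihom_quot minACA minxx minA.
Qed.
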